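(* Let $\alpha\in\mathbb{C}\setminus\{0\}$ and $T\in\mathcal{A}_\alpha$. Then $$\|T\|-\omega(T)\le\frac{1}{2|\alpha|}.$$
   Context: $\mathcal{H}$ is a separable nontrivial complex Hilbert space, $\mathcal{B}(\mathcal{H})$ is the algebra of bounded linear operators on $\mathcal{H}$ with the operator norm, and $I$ is the identity operator. For $\alpha\in\mathbb{C}\setminus\{0\}$, $\mathcal{A}_\alpha=\{T\in\mathcal{B}(\mathcal{H}):\|\alpha T-I\|\le1\}$. $\omega(T)=\sup\{|\langle Tx,x\rangle|:x\in\mathcal{H},\|x\|=1\}$ is the numerical radius. *)

(* Defs.v *)
From HB Require Import structures.
From mathcomp Require Import all_boot all_order all_algebra sesquilinear.
From mathcomp Require Import complex.
From mathcomp Require Import boolp classical_sets cardinality reals.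
From mathcomp Require Import topology normedtype.

Set Implicit Arguments.
Unset Strict Implicit.
Unset Printing Implicit Defensive.

Import Order.TTheory GRing.Theory Num.Theory.
Import numFieldNormedType.Exports.

Local Open Scope classical_set_scope.
Local Open Scope complex_scope.
Local Open Scope ring_scope.

(* MathComp's norm over [R[i]] takes values in [R[i]], with zero imaginary part;
   [rnorm] is the same norm seen as an element of [R]. *)
Definition rnorm (R : rcfType) (V : normedZmodType R[i]) (x : V) : R :=
  complex.Re `|x|.

Lemma rnormE (R : rcfType) (V : normedZmodType R[i]) (x : V) :
  (rnorm x)%:C = `|x|.
Proof. by rewrite /rnorm RRe_real // normr_real. Qed.

(* A complex Hilbert space is a [completeNormedModType R[i]] with a form
   [dot : {dot H for Num.conj}] (linear in its first argument, conjugate-linear in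
   the second, positive definite) that induces the norm. *)
Definition dot_induces_norm (R : realType) (H : normedModType R[i])
    (dot : {dot H for @Num.conj R[i]}) : Prop :=
  forall x : H, `|x| ^+ 2 = dot x x.

Definition separable_space (T : topologicalType) : Prop :=
  exists2 D : set T, countable D & dense D.

Definition bounded_operator (R : realType) (H : normedModType R[i])
    (T : {linear H -> H}) : Prop :=
  exists M : R, forall x : H, rnorm (T x) <= M * rnorm x.

(* As [sup] is total on sets of reals, this is the operator norm only for
   bounded [T]. *)
Definition opnorm (R : realType) (H : normedModType R[i])
    (T : {linear H -> H}) : R :=
  sup [set rnorm (T x) | x in [set x : H | rnorm x <= 1]].

Definition numerical_radius (R : realType) (H : normedModType R[i])
    (dot : {dot H for @Num.conj R[i]}) (T : {linear H -> H}) : R :=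
  sup [set rnorm (dot (T x) x) | x in [set x : H | rnorm x = 1]].

Definition classA (R : realType) (H : normedModType R[i]) (alpha : R[i]) :
    set {linear H -> H} :=
  [set T | bounded_operator T /\ opnorm (alpha \*: T \- idfun) <= 1].

(* Main.v *)
Require Import Defs.
From HB Require Import structures.
From mathcomp Require Import all_boot all_order all_algebra sesquilinear.
From mathcomp Require Import complex.
From mathcomp Require Import boolp classical_sets cardinality reals.
From mathcomp Require Import topology normedtype.
From mathcomp Require Import ring lra.

Set Implicit Arguments.
Unset Strict Implicit.
Unset Printing Implicit Defensive.

Import Order.TTheory GRing.Theory Num.Theory.
Import numFieldNormedType.Exports.

Local Open Scope ring_scope.

(** Write [a] for the norm of [alpha], and let [x] be a unit vector.  Expanding
    the square in the hypothesis |alpha T x - x| <= 1 cancels the two terms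
    equal to 1 and leaves
      a^2 |T x|^2 <= 2 Re (alpha <T x, x>) <= 2 a omega(T),
    that is, a |T x|^2 <= 2 omega(T) ([unit_image_sqr_le]).  A square
    dominates its tangent lines, and the tangent of slope 1 to
    t |-> a t^2 / 2 is t - 1 / (2 a); so
      |T x| - 1 / (2 a) <= a |T x|^2 / 2 <= omega(T)
    ([unit_image_le]), and the theorem follows by taking the supremum over [x].

    For the pointwise use of the suprema it must be known that they bound the
    sets over which they are taken.  For the numerical radius a crude form of
    the Cauchy-Schwarz inequality, 2 |<y, x>| <= |y|^2 + |x|^2 ([dot_le_sqr]),
    is enough, and it comes from the same expansion of a square. *)

Section RealNorm.
Context (R : rcfType) (V : normedZmodType R[i]).
Implicit Types x y : V.

Lemma rnorm_ge0 x : 0 <= rnorm x.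
Proof. by rewrite -ler0c rnormE normr_ge0. Qed.

Lemma rnorm0 : rnorm (0 : V) = 0.
Proof. by rewrite /rnorm normr0. Qed.

Lemma rnorm_eq0 x : (rnorm x == 0) = (x == 0).
Proof. by rewrite -(inj_eq (@complexI R)) rnormE normr_eq0. Qed.

Lemma ler_rnormB x y : rnorm (x - y) <= rnorm x + rnorm y.
Proof. by rewrite -lecR rmorphD /= !rnormE ler_normB. Qed.

End RealNorm.

Lemma rnormZ (R : realType) (H : normedModType R[i]) (a : R[i]) (x : H) :
  rnorm (a *: x) = rnorm a * rnorm x.
Proof. by apply: (@complexI R); rewrite rmorphM /= !rnormE normrZ. Qed.

Lemma rnormM (R : realType) (a b : R[i]) : rnorm (a * b) = rnorm a * rnorm b.
Proof. by apply: (@complexI R); rewrite rmorphM /= !rnormE normrM. Qed.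

Lemma rnorm_real (R : realType) (r : R) : rnorm (r%:C)%C = `|r|.
Proof. by rewrite /rnorm normc_def /= expr0n addr0 sqrtr_sqr. Qed.

Lemma Re_le_rnorm (R : realType) (z : R[i]) : complex.Re z <= rnorm z.
Proof.
apply: le_trans (ler_norm _) _.
by rewrite -lecR rnormE normc_ge_Re.
Qed.

Section InnerProduct.
Context (R : realType) (H : normedModType R[i]).
Context (dot : {dot H for @Num.conj R[i]}) (hdot : dot_induces_norm dot).

Lemma rnormB_sqr (x y : H) :
  rnorm (y - x) ^+ 2 =
  rnorm y ^+ 2 + rnorm x ^+ 2 - 2 * complex.Re (dot y x).
Proof.
apply: (@complexI R).
have sqrE (z : H) : ((rnorm z ^+ 2)%:C)%C = dot z z.
  by rewrite rmorphXn /= rnormE hdot.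
rewrite rmorphB rmorphD /= !sqrE dnormB /=.
congr (_ - _); case: (dot y x) => u v.
by apply/eqP; rewrite eq_complex /=; apply/andP; split; apply/eqP; ring.
Qed.

(** Rotating [y] by a phase makes <y, x> real and nonnegative without changing
    |y|; the bound is then the nonnegativity of the square of |y - x|. *)
Lemma dot_le_sqr (x y : H) :
  2 * rnorm (dot y x) <= rnorm y ^+ 2 + rnorm x ^+ 2.
Proof.
have [d0|dn0] := eqVneq (dot y x) 0.
  by rewrite d0 rnorm0 mulr0 addr_ge0 // sqr_ge0.
have nd0 : `|dot y x| != 0 by rewrite normr_eq0.
pose c := Num.conj (dot y x) / `|dot y x|.
have c1 : rnorm c = 1.
  apply: (@complexI R); rewrite rnormE /c normrM normfV norm_conjC normr_id.
  by rewrite divff.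
have cd : complex.Re (dot (c *: y) x) = rnorm (dot y x).
  by rewrite linearZl_LR /= /c mulrAC [_^* * _]mulrC -normCK expr2 mulfK.
have := sqr_ge0 (rnorm (c *: y - x)).
by rewrite rnormB_sqr cd rnormZ c1 mul1r; lra.
Qed.

Lemma opnorm_ge (T : {linear H -> H}) (x : H) :
  bounded_operator T -> rnorm x <= 1 -> rnorm (T x) <= opnorm T.
Proof.
move=> [M hM] x1; apply: ub_le_sup; last by exists x.
exists `|M| => _ [z /= z1 <-]; apply: le_trans (hM z) _.
by have := ler_norm M; have := rnorm_ge0 z; have := normr_ge0 M; nra.
Qed.

Lemma numerical_radius_ge (T : {linear H -> H}) (x : H) :
  bounded_operator T -> rnorm x = 1 ->
  rnorm (dot (T x) x) <= numerical_radius dot T.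
Proof.
move=> hT x1; apply: ub_le_sup; last by exists x.
(* [dot_le_sqr] bounds 2 |<T z, z>| by |T z|^2 + 1. *)
exists (opnorm T ^+ 2 + 1) => _ [z /= z1 <-].
have := dot_le_sqr z (T z); have := rnorm_ge0 (T z).
have := rnorm_ge0 (dot (T z) z).
have zle1 : rnorm z <= 1 by rewrite z1.
have := opnorm_ge hT zle1.
by rewrite z1; nra.
Qed.

Lemma bounded_scaleB_id (alpha : R[i]) (T : {linear H -> H}) :
  bounded_operator T -> bounded_operator (alpha \*: T \- idfun).
Proof.
move=> [M hM]; exists (rnorm alpha * M + 1) => x /=.
apply: le_trans (ler_rnormB _ _) _.
rewrite rnormZ mulrDl mul1r lerD2r -mulrA.
by apply: ler_wpM2l => //; exact: rnorm_ge0.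
Qed.

Lemma unit_image_sqr_le (alpha : R[i]) (T : {linear H -> H}) (x : H) :
  alpha != 0 -> classA alpha T -> rnorm x = 1 ->
  rnorm alpha * rnorm (T x) ^+ 2 <= 2 * numerical_radius dot T.
Proof.
move=> alpha0 [bT hT] x1.
have a0 : 0 < rnorm alpha by rewrite lt_def rnorm_ge0 rnorm_eq0 alpha0.
have xle1 : rnorm x <= 1 by rewrite x1.
have h1 := le_trans (opnorm_ge (bounded_scaleB_id alpha bT) xle1) hT.
have /= h2 : rnorm (alpha *: T x - x) ^+ 2 <= 1.
  by rewrite expr_le1 // rnorm_ge0.
have hRe := Re_le_rnorm (dot (alpha *: T x) x).
have hw := numerical_radius_ge bT x1.
move: h2 hRe; rewrite rnormB_sqr rnormZ x1 linearZl_LR /= rnormM => h2 hRe.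
rewrite -(ler_pM2l a0).
have : rnorm alpha * rnorm (dot (T x) x) <=
  rnorm alpha * numerical_radius dot T by rewrite ler_pM2l.
by move: h2 hRe; lra.
Qed.

Lemma unit_image_le (alpha : R[i]) (T : {linear H -> H}) (x : H) :
  alpha != 0 -> classA alpha T -> rnorm x = 1 ->
  rnorm (T x) <= numerical_radius dot T + 1 / (2 * rnorm alpha).
Proof.
move=> alpha0 hT x1.
have a0 : 0 < rnorm alpha by rewrite lt_def rnorm_ge0 rnorm_eq0 alpha0.
have hsq := unit_image_sqr_le alpha0 hT x1.
set a := rnorm alpha in a0 hsq *; set t := rnorm (T x) in hsq *.
have tangent : t - 1 / (2 * a) = a * t ^+ 2 / 2 - (a * t - 1) ^+ 2 / (2 * a).
  by field; rewrite gt_eqF.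
have : 0 <= (a * t - 1) ^+ 2 / (2 * a).
  by rewrite divr_ge0 ?sqr_ge0 // mulr_ge0 // ltW.
by move: tangent hsq; lra.
Qed.

End InnerProduct.

Theorem theorem4p1 (R : realType) (H : completeNormedModType R[i])
    (dot : {dot H for @Num.conj R[i]}) (hdot : dot_induces_norm dot)
    (Hsep : separable_space H) (Hnontriv : exists x : H, x != 0)
    (alpha : R[i]) (halpha : alpha != 0)
    (T : {linear H -> H}) (hT : classA alpha T) :
  opnorm T - numerical_radius dot T <= 1 / (2 * rnorm alpha).
Proof.
have unit_scale (z : H) : z != 0 ->
    exists2 u : H, rnorm u = 1 & z = (rnorm z)%:C%C *: u.
  move=> z0; have nz0 : rnorm z != 0 by rewrite rnorm_eq0.
  exists ((rnorm z)^-1%:C%C *: z).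
    by rewrite rnormZ rnorm_real ger0_norm ?invr_ge0 ?rnorm_ge0 // mulVf.
  by rewrite scalerA -rmorphM /= divff // scale1r.
rewrite lerBlDl; apply: ge_sup.
  by exists (rnorm (T 0)); exists 0 => //=; rewrite rnorm0.
move=> _ [z /= z1 <-].
(* By homogeneity the unit ball gives nothing more than the unit sphere; at
   z = 0, where there is no direction to normalise, any unit vector will do. *)
suff [u u1 Tzu] : exists2 u : H, rnorm u = 1 & rnorm (T z) <= rnorm (T u).
  exact: le_trans Tzu (unit_image_le hdot halpha hT u1).
have [->|/unit_scale[u u1 zE]] := eqVneq z 0.
  have [w /unit_scale[u u1 _]] := Hnontriv; exists u => //.
  by rewrite linear0 rnorm0 rnorm_ge0.
exists u => //; rewrite zE linearZ /= rnormZ rnorm_real.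
by rewrite ger0_norm ?rnorm_ge0 // ler_piMl // rnorm_ge0.
Qed.
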